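(* The category $\mathbf{PZLC}$ is dually equivalent to the category $\mathbf{PLBA}$.
   Context: $\mathbf{PZLC}$ is the category of all locally compact zero-dimensional (having a base of clopen sets) Hausdorff spaces and all perfect maps between them. A map is perfect if it is continuous, closed and has compact point-inverses (it need not be onto). A local Boolean algebra (LBA) is a pair $(A,I)$ where $A$ is a Boolean algebra ($0=1$ allowed) and $I$ is an ideal of $A$ (possibly $I=A$) which is dense in $A$, i.e. for every $a\in A\setminus\{0\}$ there is $b\in I\setminus\{0\}$ with $b\le a$. An LBA $(A,I)$ is a prime local Boolean algebra (PLBA) if $I=A$ or $I$ is a prime ideal of $A$. $\mathbf{PLBA}$ is the category whose objects are all PLBAs and whose morphisms $\varphi:(A,I)\to(B,J)$ are all Boolean homomorphisms $\varphi:A\to B$ such that (LBA) for every $b\in J$ there exists $a\in I$ with $b\le\varphi(a)$, and (PLBA) $\varphi(I)\subseteq J$; composition and identities are the usual ones of functions. Two categories are dually equivalent if one is equivalent to the opposite of the other. *)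

(* Defs.v *)
From HB Require Import structures.
From mathcomp Require Import all_boot all_order.
From mathcomp Require Import all_classical.
From mathcomp Require Import topology.

Set Implicit Arguments.
Unset Strict Implicit.
Unset Printing Implicit Defensive.
Import Order.TTheory.

Local Open Scope classical_set_scope.

(** * Categories *)

Record category := Category {
  obj :> Type;
  hom : obj -> obj -> Type;
  idm : forall a, hom a a;
  comp : forall a b c, hom b c -> hom a b -> hom a c;
  comp_idl : forall a b (f : hom a b), comp (idm b) f = f;
  comp_idr : forall a b (f : hom a b), comp f (idm a) = f;
  comp_assoc : forall a b c d (h : hom c d) (g : hom b c) (f : hom a b),
    comp h (comp g f) = comp (comp h g) f
}.
Arguments idm {c0} a.
Arguments comp {c0 a b c}.

Definition opposite (C : category) : category :=
  @Category C (fun a b => @hom C b a) (@idm C)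
    (fun a b c g f => comp f g)
    (fun a b f => comp_idr f) (fun a b f => comp_idl f)
    (fun a b c d h g f => esym (comp_assoc f g h)).

Record functor (C D : category) := Functor {
  fobj :> C -> D;
  fmap : forall a b : C, hom a b -> hom (fobj a) (fobj b);
  fmap_id : forall a : C, fmap (idm a) = idm (fobj a);
  fmap_comp : forall (a b c : C) (g : hom b c) (f : hom a b),
    fmap (comp g f) = comp (fmap g) (fmap f)
}.

Definition functor_id (C : category) : functor C C :=
  @Functor C C (fun a => a) (fun a b f => f)
    (fun a => erefl) (fun a b c g f => erefl).

Section FunctorComp.
Context (C D E : category) (G : functor D E) (F : functor C D).

Let cmap (a b : C) (f : hom a b) : hom (G (F a)) (G (F b)) :=
  fmap G (fmap F f).

Lemma functor_comp_id (a : C) : cmap (idm a) = idm (G (F a)).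
Proof. by rewrite /cmap !fmap_id. Qed.

Lemma functor_comp_comp (a b c : C) (g : hom b c) (f : hom a b) :
  cmap (comp g f) = comp (cmap g) (cmap f).
Proof. by rewrite /cmap !fmap_comp. Qed.

Definition functor_comp : functor C E :=
  @Functor C E (fun a => G (F a)) cmap functor_comp_id functor_comp_comp.

End FunctorComp.

Definition is_iso (C : category) (a b : C) (f : hom a b) : Prop :=
  exists g : hom b a, comp g f = idm a /\ comp f g = idm b.

Definition naturally_isomorphic (C D : category) (F G : functor C D) : Prop :=
  exists eta : forall a : C, hom (F a) (G a),
    (forall (a b : C) (f : hom a b),
       comp (eta b) (fmap F f) = comp (fmap G f) (eta a)) /\
    (forall a : C, is_iso (eta a)).

Definition equivalent (C D : category) : Prop :=
  exists (F : functor C D) (G : functor D C),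
    naturally_isomorphic (functor_comp G F) (functor_id C) /\
    naturally_isomorphic (functor_comp F G) (functor_id D).

Definition dually_equivalent (C D : category) : Prop :=
  equivalent C (opposite D).

(** * Locally compact zero-dimensional spaces and perfect maps *)

(* The library's [zero_dimensional] only asks that points be separated by
   clopen sets, which in general is weaker than having a clopen base. *)
Definition has_clopen_base (X : topologicalType) : Prop :=
  exists2 B : set (set X), B `<=` clopen & basis B.

Definition closed_map (X Y : topologicalType) (f : X -> Y) : Prop :=
  forall A : set X, closed A -> closed (f @` A).

Definition perfect (X Y : topologicalType) (f : X -> Y) : Prop :=
  [/\ continuous f, closed_map f & forall y, compact (f @^-1` [set y])].

Lemma perfect_id (X : topologicalType) : perfect (@idfun X).
Proof.
split.
- by move=> x; exact: cvg_id.
- by move=> A; rewrite image_id.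
- by move=> y; exact: compact_set1.
Qed.

Lemma perfect_preimage_compact (X Y : topologicalType) (f : X -> Y)
    (K : set Y) : perfect f -> compact K -> compact (f @^-1` K).
Proof.
move=> [cf clf fibf] cK F PF FK.
have [y [Ky Fy]] : K `&` cluster (f @ F) !=set0 by exact: cK.
pose G := filter_from F (fun S => closure S `&` f @^-1` [set y]).
have GF : Filter G.
  apply: filter_from_filter; first by exists setT; exact: filterT.
  move=> S T FS FT; exists (S `&` T); first exact: filterI.
  by move=> x [/closureI [? ?] ?].
have PG : ProperFilter G.
  apply: filter_from_proper => S FS.
  have : closure (f @` closure S) y.
    move=> V Vy; apply: Fy => //=; apply: filterS FS => x Sx.
    by exists x => //; exact: subset_closure.
  have /closure_id <- := clf _ (@closed_closure _ S).
  by move=> [x Sx fxy]; exists x.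
have Gy : G (f @^-1` [set y]).
  by exists setT; [exact: filterT|move=> x []].
have [x [fxy Gx]] := fibf y G PG Gy.
exists x; split; first by rewrite /preimage /= fxy.
move=> S V FS Vx.
have clS : closure (closure S) x.
  by move=> W Wx; apply: Gx => //; exists S => // z [].
have /closure_id clSE := @closed_closure _ S.
by rewrite -clSE in clS; exact: clS.
Qed.

Lemma perfect_comp (X Y Z : topologicalType) (g : Y -> Z) (f : X -> Y) :
  perfect g -> perfect f -> perfect (g \o f).
Proof.
move=> pg pf; have [cg clg fibg] := pg; have [cf clf _] := pf; split.
- by move=> x; apply: continuous_comp; [exact: cf|exact: cg].
- by move=> A cA; rewrite -image_comp; apply: clg; apply: clf.
- by move=> z; rewrite comp_preimage; exact: perfect_preimage_compact.
Qed.

Record pzlc_obj := PzlcObj {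
  pzlc_space :> topologicalType;
  pzlc_locally_compact : locally_compact [set: pzlc_space];
  pzlc_clopen_base : has_clopen_base pzlc_space;
  pzlc_hausdorff : hausdorff_space pzlc_space
}.

Definition pzlc_hom (X Y : pzlc_obj) : Type := {f : X -> Y | perfect f}.

Definition pzlc_id (X : pzlc_obj) : pzlc_hom X X := exist _ _ (@perfect_id X).

Definition pzlc_comp (X Y Z : pzlc_obj)
    (g : pzlc_hom Y Z) (f : pzlc_hom X Y) : pzlc_hom X Z :=
  exist _ (sval g \o sval f) (perfect_comp (svalP g) (svalP f)).

Lemma pzlc_comp_idl (X Y : pzlc_obj) (f : pzlc_hom X Y) :
  pzlc_comp (pzlc_id Y) f = f.
Proof. by case: f => f pf; exact: eq_exist. Qed.

Lemma pzlc_comp_idr (X Y : pzlc_obj) (f : pzlc_hom X Y) :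
  pzlc_comp f (pzlc_id X) = f.
Proof. by case: f => f pf; exact: eq_exist. Qed.

Lemma pzlc_comp_assoc (X Y Z W : pzlc_obj) (h : pzlc_hom Z W)
    (g : pzlc_hom Y Z) (f : pzlc_hom X Y) :
  pzlc_comp h (pzlc_comp g f) = pzlc_comp (pzlc_comp h g) f.
Proof. exact: eq_exist. Qed.

Definition PZLC : category :=
  @Category pzlc_obj pzlc_hom pzlc_id pzlc_comp
    pzlc_comp_idl pzlc_comp_idr pzlc_comp_assoc.


(** * Prime local Boolean algebras *)

(* Boolean algebras are [ctbDistrLatticeType]s: complemented distributive
   lattices with \bot and \top, where \bot = \top is possible. *)

Local Open Scope order_scope.

Section LocalBooleanAlgebra.
Context {d : Order.disp_t} {A : ctbDistrLatticeType d}.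
Implicit Type I : set A.

Definition ideal I : Prop :=
  [/\ I \bot,
      forall a b, I a -> b <= a -> I b &
      forall a b, I a -> I b -> I (a `|` b)].

Definition prime_ideal I : Prop :=
  [/\ ideal I, I <> setT & forall a b, I (a `&` b) -> I a \/ I b].

Definition dense_ideal I : Prop :=
  forall a, a <> \bot -> exists b, [/\ I b, b <> \bot & b <= a].

Definition is_LBA I : Prop := ideal I /\ dense_ideal I.

Definition is_PLBA I : Prop := is_LBA I /\ (I = setT \/ prime_ideal I).

End LocalBooleanAlgebra.

(* The library's [{tblmorphism A -> B}] only preserves \bot and \top. *)
Definition boolean_hom dA (A : ctbDistrLatticeType dA)
    dB (B : ctbDistrLatticeType dB) (phi : A -> B) : Prop :=
  [/\ phi \bot = \bot, phi \top = \top,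
      {morph phi : a b / a `&` b}, {morph phi : a b / a `|` b} &
      {morph phi : a / ~` a}].

Definition plba_morphism dA (A : ctbDistrLatticeType dA)
    dB (B : ctbDistrLatticeType dB) (I : set A) (J : set B)
    (phi : A -> B) : Prop :=
  [/\ boolean_hom phi,
      forall b, J b -> exists2 a, I a & b <= phi a &
      (phi @` I `<=` J)%classic].

Lemma plba_morphism_id d (A : ctbDistrLatticeType d) (I : set A) :
  plba_morphism I I idfun.
Proof.
split.
- by split.
- by move=> b Ib; exists b.
- by move=> _ [a Ia <-].
Qed.

Lemma plba_morphism_comp dA (A : ctbDistrLatticeType dA)
    dB (B : ctbDistrLatticeType dB) dC (C : ctbDistrLatticeType dC)
    (I : set A) (J : set B) (K : set C) (psi : B -> C) (phi : A -> B) :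
  plba_morphism J K psi -> plba_morphism I J phi ->
  plba_morphism I K (psi \o phi).
Proof.
move=> [[q0 q1 qI qU qC] qL qP] [[p0 p1 pI pU pC] pL pP]; split.
- split=> [||a b|a b|a] /=.
  + by rewrite p0 q0.
  + by rewrite p1 q1.
  + by rewrite pI qI.
  + by rewrite pU qU.
  + by rewrite pC qC.
- move=> c /qL[b /pL[a Ia leb] lec]; exists a => //.
  apply: le_trans lec _ => /=.
  by move/join_idPl: leb => <-; rewrite qU leUr.
- move=> _ [a Ia <-]; apply: qP; exists (phi a) => //.
  by apply: pP; exists a.
Qed.

Record plba_obj := PlbaObj {
  plba_disp : Order.disp_t;
  plba_alg :> ctbDistrLatticeType plba_disp;
  plba_ideal : set plba_alg;
  plba_is_PLBA : is_PLBA plba_ideal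
}.

Definition plba_hom (A B : plba_obj) : Type :=
  {phi : A -> B | plba_morphism (@plba_ideal A) (@plba_ideal B) phi}.

Definition plba_id (A : plba_obj) : plba_hom A A :=
  exist _ _ (plba_morphism_id (@plba_ideal A)).

Definition plba_comp (A B C : plba_obj)
    (psi : plba_hom B C) (phi : plba_hom A B) : plba_hom A C :=
  exist _ (sval psi \o sval phi)
    (plba_morphism_comp (svalP psi) (svalP phi)).

Lemma plba_comp_idl (X Y : plba_obj) (f : plba_hom X Y) :
  plba_comp (plba_id Y) f = f.
Proof. by case: f => f pf; exact: eq_exist. Qed.

Lemma plba_comp_idr (X Y : plba_obj) (f : plba_hom X Y) :
  plba_comp f (plba_id X) = f.
Proof. by case: f => f pf; exact: eq_exist. Qed.

Lemma plba_comp_assoc (X Y Z W : plba_obj) (h : plba_hom Z W)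
    (g : plba_hom Y Z) (f : plba_hom X Y) :
  plba_comp h (plba_comp g f) = plba_comp (plba_comp h g) f.
Proof. exact: eq_exist. Qed.

Definition PLBA : category :=
  @Category plba_obj plba_hom plba_id plba_comp
    plba_comp_idl plba_comp_idr plba_comp_assoc.

(* Main.v *)
(** Both functors are the two halves of Stone duality, restricted to what a
    noncompact space still sees. A space X is sent to the clopen sets that are
    compact or have compact complement, with the compact ones as the ideal:
    this ideal is everything if X is compact and prime otherwise, and it is
    dense because X has a base of compact clopen sets. A pair (A, I) is sent to
    the space of those ultrafilters of A that meet I; only the ultrafilter
    A \ I can be lost, and density of I says that no nonzero element is
    concentrated at it. The unit is x |-> {U | x in U}, the counit
    a |-> {u | a in u}. *)

From HB Require Import structures.
From mathcomp Require Import all_boot all_order.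
From mathcomp Require Import all_classical.
From mathcomp Require Import topology.
Require Import Defs.

Set Implicit Arguments.
Unset Strict Implicit.
Unset Printing Implicit Defensive.
Import Order.Theory.

Local Open Scope classical_set_scope.

(** * Natural isomorphisms *)

(** The unit runs from the identity to the composite, whereas [equivalent] asks for the opposite
    direction. The chosen inverses are natural: compose the naturality square of [eta] with them on
    both sides. *)
Lemma naturally_isomorphic_sym (C D : category) (F G : functor C D) :
  naturally_isomorphic F G -> naturally_isomorphic G F.
Proof.
move=> [eta [nat_eta iso_eta]].
exists (fun a => sval (cid (iso_eta a))); split=> [a b f|a].
  have [_ ra] := svalP (cid (iso_eta a)); have [lb _] := svalP (cid (iso_eta b)).
  set ia := sval _ in ra *; set ib := sval _ in lb *.
  rewrite -[LHS]comp_idr -ra -comp_assoc [comp _ (comp _ ia)]comp_assoc.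
  by rewrite -nat_eta -comp_assoc comp_assoc lb comp_idl.
have [l r] := svalP (cid (iso_eta a)).
by exists (eta a).
Qed.

(** Bijectivity alone does not suffice: the inverse has to respect the ideals too, so [phi] must
    reflect them. Condition (LBA) for the inverse then comes from condition (PLBA) for [phi]. *)
Lemma plba_is_iso (A B : PLBA) (phi : hom A B) :
  injective (sval phi) -> (forall b, exists a, sval phi a = b) ->
  (forall a, @plba_ideal B (sval phi a) -> @plba_ideal A a) -> is_iso phi.
Proof.
case: phi => phi phiM /= injphi /choice[psi phiK] idphi.
have psiK a : psi (phi a) = a by apply: injphi; rewrite phiK.
have [[p0 p1 pI pU pC] pL pP] := phiM.
have psiM : plba_morphism (@plba_ideal B) (@plba_ideal A) psi.
  split; first split=> [||a b|a b|a]; try apply: injphi.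
  - by rewrite phiK p0.
  - by rewrite phiK p1.
  - by rewrite pI !phiK.
  - by rewrite pU !phiK.
  - by rewrite pC !phiK.
  - move=> a Ia; exists (phi a); last by rewrite psiK.
    by apply: pP; exists a.
  - by move=> _ [b Jb <-]; apply: idphi; rewrite phiK.
by exists (exist _ psi psiM); split; apply: eq_exist; apply/funext.
Qed.

Lemma perfect_homeomorphism (X Y : topologicalType) (f : X -> Y) (g : Y -> X) :
  continuous f -> continuous g -> cancel f g -> cancel g f -> perfect f.
Proof.
move=> cf cg fK gK; split=> // [A cA|y].
  rewrite (_ : f @` A = g @^-1` A); first exact: preimage_closed.
  apply/seteqP; split=> [_ [x Ax <-]|y Ay]; first by rewrite /preimage /= fK.
  by exists (g y).
rewrite (_ : _ @^-1` _ = [set g y]); first exact: compact_set1.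
by apply/seteqP; split=> x /=; [move=> <-; rewrite fK|move=> ->; rewrite gK].
Qed.

Lemma pzlc_is_iso (X Y : PZLC) (f : hom X Y) (g : Y -> X) :
  continuous g -> cancel (sval f) g -> cancel g (sval f) -> is_iso f.
Proof.
case: f => f pf /= cg fK gK; have [cf _ _] := pf.
exists (exist _ g (perfect_homeomorphism cg cf gK fK)).
by split; apply: eq_exist; apply/funext.
Qed.

(** * Ultrafilters in Boolean algebras *)

Section Ultrafilter.
Local Open Scope order_scope.
Context {d : Order.disp_t} {A : ctbDistrLatticeType d}.
Implicit Types (u : set A) (a b c : A).

Definition ultrafilter u : Prop :=
  [/\ ~ u \bot, forall a b, u a -> a <= b -> u b,
      forall a b, u a -> u b -> u (a `&` b) & forall a, u a \/ u (~` a)].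

Lemma ultrafilterT u : ultrafilter u -> u \top.
Proof. by move=> [u0 uS _ uC]; case: (uC \top) => // /uS; exact. Qed.

Lemma ultrafilterI u a b : ultrafilter u -> u (a `&` b) <-> u a /\ u b.
Proof.
move=> [_ uS uI _]; split=> [uab|[]]; last exact: uI.
by split; apply: uS uab _; [exact: leIl|exact: leIr].
Qed.

Lemma ultrafilterC u a : ultrafilter u -> u (~` a) <-> ~ u a.
Proof.
move=> [u0 _ uI uC]; split=> [uCa ua|]; last by case: (uC a).
by apply: u0; rewrite -(meetxC a); exact: uI.
Qed.

Lemma ultrafilterU u a b : ultrafilter u -> u (a `|` b) <-> u a \/ u b.
Proof.
move=> uu; rewrite -[a `|` b]complK complU ultrafilterC// ultrafilterI//.
by rewrite !ultrafilterC// not_andP !notK.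
Qed.

(** Ultrafilters are maximal: if [a] in [v] were missing from [u], its complement would lie in [u],
    hence in [v]. *)
Lemma sub_ultrafilter u v :
  ultrafilter u -> ultrafilter v -> (u `<=` v)%classic -> u = v.
Proof.
move=> uu uv suv; apply/seteqP; split=> // a va.
by apply: contrapT => /(ultrafilterC _ uu)/suv/(ultrafilterC _ uv).
Qed.

(** Zorn's lemma, applied to the possibly empty filters all of whose members have nonzero meet with
    [a]. *)
Lemma ultrafilter_exists a : a <> \bot -> exists2 u, ultrafilter u & u a.
Proof.
move=> a0.
pose P u := [/\ forall b c, u b -> b <= c -> u c,
  forall b c, u b -> u c -> u (b `&` c) & forall b, u b -> b `&` a <> \bot].
have [F FP Ftot|u [[uS uI ua] umax]] := @Zorn_bigcup A P.
  split=> [b c [u Fu ub] bc|b c [u Fu ub] [v Fv vc]|b [u Fu ub]].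
  - by exists u => //; have [uS _ _] := FP _ Fu; exact: uS bc.
  - have [_ uI _] := FP _ Fu; have [_ vI _] := FP _ Fv.
    have [uv|vu] := Ftot _ _ Fu Fv; [exists v => //|exists u => //].
      by apply: vI => //; exact: uv.
    by apply: uI => //; exact: vu.
  - by have [_ _] := FP _ Fu; exact.
(* [u] may a priori be empty, so [\top] is adjoined to it. *)
pose w : set A := fun b => b = \top \/ u b.
have wI b c : w b -> w c -> w (b `&` c).
  move=> [->|ub] [->|uc]; rewrite ?meet1x ?meetx1; [by left|by right|by right|].
  by right; exact: uI.
(* Maximality in usable form: otherwise the filter [v] generated by [w] and [c] would properly
   extend [u]. *)
have uP c : (forall b, w b -> b `&` c `&` a <> \bot) -> u c.
  move=> wca; apply: contrapT => nuc.
  pose v : set A := fun x => exists2 b, w b & b `&` c <= x.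
  apply: (umax v); last split.
  - split=> [b ub|vu]; first by exists b; [right|exact: leIl].
    by apply/nuc/vu; exists \top; [left|rewrite meet1x].
  - by move=> x y [b wb bx] xy; exists b => //; exact: le_trans bx xy.
  - move=> x y [b wb bx] [b' wb' by_]; exists (b `&` b'); first exact: wI.
    rewrite lexI (le_trans _ bx) ?(le_trans _ by_)// leI2// ?leIl//.
    by rewrite leIr.
  - move=> x [b wb bx] xa0; apply: (wca b wb).
    by apply/eqP; rewrite -lex0 -xa0 leI2.
have wa b : w b -> b `&` a <> \bot.
  by move=> [->|/ua//]; rewrite meet1x.
exists u; last by apply: uP => b wb; rewrite -meetA meetxx; exact: wa.
split=> // [/ua|c]; first by rewrite meet0x.
(* If [c] and its complement are both missing, each is disjoint from [b]&[a] for some [b] in [w].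
   Splitting along [c] then makes the meet of the two witnesses disjoint from [a]. *)
apply: contrapT => /not_orP[nuc nuCc].
have /existsNP[b /not_implyP[wb /contrapT b0]] := contra_not (uP c) nuc.
apply: nuCc; apply: uP => b' wb' b'0; apply: (wa (b `&` b')); first exact: wI.
rewrite -[b `&` b']meetx1 -(joinxC c) meetUr meetUl.
apply/eqP; rewrite -lex0 leUx -{1}b0 -b'0.
by rewrite !leI2// ?leIl// leIr.
Qed.

End Ultrafilter.

(** * Compactness and clopen sets *)

(** Directedness replaces finite subcovers by a single member. If no [U] in [W] contained [K], the
    sets [K \ U] would generate a proper filter; a cluster point of it in [K] has a neighbourhood
    [U] in [W], which misses [K \ U]. *)
Lemma compact_directed_cover (X : topologicalType) (K : set X)
    (W : set (set X)) :
  compact K -> (forall U V, W U -> W V -> exists2 T, W T & U `|` V `<=` T) ->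
  W !=set0 -> (forall x, K x -> exists2 U, W U & nbhs x U) ->
  exists2 U, W U & K `<=` U.
Proof.
move=> cK dirW [U0 WU0] KW; apply: contrapT => noU.
pose F := filter_from W (fun U => K `\` U).
have FF : ProperFilter F.
  apply: filter_from_proper.
    apply: filter_from_filter; first by exists U0.
    move=> U V WU WV; have [T WT UVT] := dirW _ _ WU WV; exists T => //.
    by move=> x [Kx nTx]; split; split=> // ?; apply/nTx/UVT; [left|right].
  move=> U WU; apply: contrapT => KU; apply: noU; exists U => // x Kx.
  by apply: contrapT => nUx; apply: KU; exists x.
have [x [Kx Fx]] : K `&` cluster F !=set0.
  by apply: cK; exists U0 => // x [].
have [U WU Ux] := KW x Kx.
have [|y [[_ nUy] Uy]] := Fx (K `\` U) U _ Ux; first by exists U.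
exact: nUy.
Qed.

(** A basic clopen set inside both [U] and a compact neighbourhood [C] of [x] is closed in [C],
    hence compact. *)
Lemma compact_clopen_nbhs (X : topologicalType) (x : X) (U : set X) :
  locally_compact [set: X] -> has_clopen_base X -> nbhs x U ->
  exists K, [/\ clopen K, compact K, K x & K `<=` U].
Proof.
move=> /(_ x I)[C]; rewrite /within /= => xC [cC clC] [B Bclopen [_ Bbase]] xU.
have {}xC : nbhs x C by apply: filterS xC => y; exact.
have [K [BK Kx] KCU] := Bbase x _ (filterI xC xU).
exists K; split=> // [||y /KCU[]//]; first exact: Bclopen.
apply: subclosed_compact cC _; last by move=> y /KCU[].
by have [] := Bclopen _ BK.
Qed.

(** * The algebra of compact or cocompact clopen sets *)

Section ClopenAlgebra.
Context (X : topologicalType).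

(** These sets form the Boolean algebra generated by the compact clopen sets: an ideal together with
    its dual filter. *)
Definition compact_or_cocompact (U : set X) : Prop :=
  clopen U /\ (compact U \/ compact (~` U)).

Definition ccc : Type := {U : set X | compact_or_cocompact U}.

HB.instance Definition _ := gen_eqMixin ccc.
HB.instance Definition _ := gen_choiceMixin ccc.

Lemma ccc_inj (U V : ccc) : sval U = sval V -> U = V.
Proof. by case: U V => [U pU] [V pV] /= ?; exact: eq_exist. Qed.

Lemma compact_or_cocompactC U :
  compact_or_cocompact U -> compact_or_cocompact (~` U).
Proof.
move=> [clU cU]; split; first exact: clopenC.
by rewrite setCK; case: cU; [right|left].
Qed.

Lemma compact_or_cocompactI U V :
  compact_or_cocompact U -> compact_or_cocompact V ->
  compact_or_cocompact (U `&` V).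
Proof.
move=> [clU cU] [clV cV]; split; first exact: clopenI.
have [? kU] := clU; have [? kV] := clV.
case: cU => cU; first by left; exact: compact_closedI.
case: cV => cV; first by left; rewrite setIC; exact: compact_closedI.
by right; rewrite setCI; exact: compactU.
Qed.

Lemma compact_or_cocompact0 : compact_or_cocompact set0.
Proof. by split; [exact: clopen0|left; exact: compact0]. Qed.

Lemma compact_or_cocompactT : compact_or_cocompact setT.
Proof.
by rewrite -setC0; apply: compact_or_cocompactC; exact: compact_or_cocompact0.
Qed.

Lemma compact_or_cocompactU U V :
  compact_or_cocompact U -> compact_or_cocompact V ->
  compact_or_cocompact (U `|` V).
Proof.
move=> cU cV; rewrite -[U `|` V]setCK setCU; apply: compact_or_cocompactC.
by apply: compact_or_cocompactI; exact: compact_or_cocompactC.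
Qed.

Definition ccc0 : ccc := exist _ _ compact_or_cocompact0.
Definition cccT : ccc := exist _ _ compact_or_cocompactT.
Definition cccC (U : ccc) : ccc := exist _ _ (compact_or_cocompactC (svalP U)).
Definition cccI (U V : ccc) : ccc :=
  exist _ _ (compact_or_cocompactI (svalP U) (svalP V)).
Definition cccU (U V : ccc) : ccc :=
  exist _ _ (compact_or_cocompactU (svalP U) (svalP V)).

Let le_def U V : `[< sval U `<=` sval V >] = (cccI U V == U).
Proof.
apply/asboolP/eqP => [/setIidPl UV|<-]; first exact: ccc_inj.
exact: subIsetr.
Qed.
Let cccIC : commutative cccI.
Proof. by move=> U V; apply: ccc_inj; exact: setIC. Qed.
Let cccUC : commutative cccU.
Proof. by move=> U V; apply: ccc_inj; exact: setUC. Qed.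
Let cccIA : associative cccI.
Proof. by move=> U V W; apply: ccc_inj; exact: setIA. Qed.
Let cccUA : associative cccU.
Proof. by move=> U V W; apply: ccc_inj; exact: setUA. Qed.
Let cccUKI V U : cccI U (cccU U V) = U.
Proof. by apply: ccc_inj; rewrite /= setUC setKU. Qed.
Let cccIKU V U : cccU U (cccI U V) = U.
Proof. by apply: ccc_inj; rewrite /= setIC setKI. Qed.
Let cccIUl : left_distributive cccI cccU.
Proof. by move=> U V W; apply: ccc_inj; exact: setIUl. Qed.
Let cccIid : idempotent_op cccI.
Proof. by move=> U; apply: ccc_inj; exact: setIid. Qed.

HB.instance Definition _ := Order.isMeetJoinDistrLattice.Build set_display ccc
  le_def (fun _ _ => erefl) cccIC cccUC cccIA cccUA cccUKI cccIKU cccIUl cccIid.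

Let ccc0_le U : (ccc0 <= U)%O.
Proof. by apply/asboolP; exact: sub0set. Qed.
HB.instance Definition _ := Order.hasBottom.Build set_display ccc ccc0_le.

Let ccc_leT U : (U <= cccT)%O.
Proof. by apply/asboolP; exact: subsetT. Qed.
HB.instance Definition _ := Order.hasTop.Build set_display ccc ccc_leT.

Let cccUC1 U : cccU U (cccC U) = cccT.
Proof. by apply: ccc_inj; exact: setUv. Qed.
Let cccIC0 U : cccI U (cccC U) = ccc0.
Proof. by apply: ccc_inj; exact: setICr. Qed.
HB.instance Definition _ :=
  Order.TBDistrLattice_hasComplement.Build set_display ccc cccUC1 cccIC0.

Lemma ccc_leP (U V : ccc) : (U <= V)%O <-> sval U `<=` sval V.
Proof. by split=> /asboolP. Qed.

Definition ccc_ideal : set ccc := [set U | compact (sval U)].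

End ClopenAlgebra.

Lemma ccc_ideal_ideal (X : topologicalType) : ideal (@ccc_ideal X).
Proof.
split=> [|U V cU /ccc_leP VU|U V]; first exact: compact0.
  by have [[_ clV] _] := svalP V; exact: subclosed_compact cU VU.
exact: compactU.
Qed.

Lemma ccc_is_PLBA (X : pzlc_obj) : is_PLBA (@ccc_ideal X).
Proof.
split; first split; first exact: ccc_ideal_ideal.
- move=> U U0.
  have [x Ux] : sval U !=set0.
    by apply/set0P/negP => /eqP U0'; apply: U0; exact: ccc_inj.
  have [[oU _] _] := svalP U.
  have [K [clK cK Kx KU]] := compact_clopen_nbhs
    (@pzlc_locally_compact X) (@pzlc_clopen_base X) (open_nbhs_nbhs (conj oU Ux)).
  exists (exist _ K (conj clK (or_introl cK))); split=> //; last exact/ccc_leP.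
  by move=> /(congr1 sval)/= K0; rewrite K0 in Kx.
- have [cX|ncX] := pselect (compact [set: X]).
    left; apply/seteqP; split=> // U _; have [[_ clU] _] := svalP U.
    exact: subclosed_compact cX _.
  right; split; first exact: ccc_ideal_ideal.
  + by move=> IT; apply: ncX; have : ccc_ideal (@cccT X) by rewrite IT.
  + move=> U V cUV; have [_ [cU|cU]] := svalP U; first by left.
    have [_ [cV|cV]] := svalP V; first by right.
    (* With [U] and [V] both cocompact, the space is the union of three compact sets: [U]&[V] and
       the two complements. *)
    case: ncX; rewrite -(setUv (sval U `&` sval V)) setCI.
    by apply: compactU => //; exact: compactU.
Qed.

Definition ccc_plba (X : pzlc_obj) : plba_obj := PlbaObj (ccc_is_PLBA X).

(** * Action of perfect maps on clopen sets *)

Section Preimage.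
Context (X Y : pzlc_obj) (f : pzlc_hom X Y).

Lemma preimage_ccc (U : set Y) :
  compact_or_cocompact U -> compact_or_cocompact (sval f @^-1` U).
Proof.
have pf := svalP f; have [cf _ _] := pf.
move=> [[oU kU] cU]; split; first split.
- by apply: open_comp => // x _; exact: cf.
- by apply: preimage_closed => // x _; exact: cf.
- rewrite preimage_setC.
  by case: cU => cU; [left|right]; exact: perfect_preimage_compact.
Qed.

Definition ccc_preimage (U : ccc Y) : ccc X :=
  exist _ _ (preimage_ccc (svalP U)).

Lemma ccc_preimage_morphism :
  plba_morphism (@ccc_ideal Y) (@ccc_ideal X) ccc_preimage.
Proof.
have pf := svalP f; have [cf _ _] := pf; split.
- by split=> [||U V|U V|U]; exact: ccc_inj.
- move=> K cK.
  (* Condition (LBA): the image of [K] is compact, so one compact clopen [V] contains it, and the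
     preimage of [V] contains [K]. *)
  have [|U V [? ?] [? ?]||y [x Kx <-]|V [clV cV] KV] :=
    @compact_directed_cover Y (sval f @` sval K)
      [set V | clopen V /\ compact V].
  + apply: continuous_compact => //; exact: continuous_subspaceT.
  + exists (U `|` V) => //; split; [exact: clopenU|exact: compactU].
  + by exists set0; split; [exact: clopen0|exact: compact0].
  + have [V [clV cV Vy _]] := compact_clopen_nbhs
      (@pzlc_locally_compact Y) (@pzlc_clopen_base Y) (@filterT _ (nbhs (sval f x)) _).
    by exists V => //; apply: open_nbhs_nbhs; split=> //; case: clV.
  + exists (exist _ V (conj clV (or_introl cV))) => //.
    by apply/ccc_leP => x Kx; apply: KV; exists x.
- by move=> _ [U cU <-]; exact: perfect_preimage_compact.
Qed.

Definition ccc_fmap : plba_hom (ccc_plba Y) (ccc_plba X) :=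
  exist _ _ ccc_preimage_morphism.

End Preimage.

Definition ccc_functor : functor PZLC (opposite PLBA).
Proof.
refine (@Functor PZLC (opposite PLBA) ccc_plba (@ccc_fmap) _ _).
- by move=> X; apply: eq_exist; apply/funext => U; exact: ccc_inj.
- by move=> X Y Z g f; apply: eq_exist; apply/funext => U; exact: ccc_inj.
Defined.

(** * The space of ultrafilters meeting the ideal *)

Section Spectrum.
Context {d : Order.disp_t} {A : ctbDistrLatticeType d} (I : set A).

Definition spectrum : Type :=
  {u : set A | ultrafilter u /\ exists2 a, I a & u a}.

HB.instance Definition _ := gen_eqMixin spectrum.
HB.instance Definition _ := gen_choiceMixin spectrum.

Definition Spectrum (u : set A) (uu : ultrafilter u)
    (Iu : exists2 a, I a & u a) : spectrum :=
  exist _ u (conj uu Iu).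

Definition basic (a : A) : set spectrum := [set u | sval u a].

(** The Stone topology. The sets [basic a] cover the space and are closed under intersection, so
    they are a base of it. *)
Definition spectrum_open : set_system spectrum :=
  [set U | forall u, U u -> exists2 a, sval u a & basic a `<=` U].

Let spectrum_openT : spectrum_open setT.
Proof. by move=> u _; have [_ [a _ ua]] := svalP u; exists a. Qed.

Let spectrum_openI U V :
  spectrum_open U -> spectrum_open V -> spectrum_open (U `&` V).
Proof.
move=> oU oV u [/oU[a ua aU] /oV[b ub bV]]; have [uu _] := svalP u.
exists (a `&` b)%O; first exact/ultrafilterI.
move=> v; have [uv _] := svalP v; rewrite /basic /= ultrafilterI// => -[va vb].
by split; [exact: aU|exact: bV].
Qed.

Let spectrum_open_bigcup (J : Type) (f : J -> set spectrum) :
  (forall j, spectrum_open (f j)) -> spectrum_open (\bigcup_j f j).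
Proof.
move=> of_ u [j _ /of_[a ua af]]; exists a => //.
by move=> v /af fv; exists j.
Qed.

HB.instance Definition _ := isOpenTopological.Build spectrum
  spectrum_openT spectrum_openI spectrum_open_bigcup.

Lemma spectrum_inj (u v : spectrum) : sval u `<=` sval v -> u = v.
Proof.
case: u v => [u [uu Iu]] [v [uv Iv]] /= uv_sub.
by apply: eq_exist; exact: sub_ultrafilter.
Qed.

Lemma basic0 : basic \bot%O = set0.
Proof. by apply/seteqP; split=> // u; have [[]] := svalP u. Qed.

Lemma basicT : basic \top%O = setT.
Proof.
by apply/seteqP; split=> // u _; have [uu _] := svalP u; exact: ultrafilterT.
Qed.

Lemma basicI a b : basic (a `&` b)%O = basic a `&` basic b.
Proof.
by apply/funext => u; apply/propext; have [uu _] := svalP u; exact: ultrafilterI.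
Qed.

Lemma basicU a b : basic (a `|` b)%O = basic a `|` basic b.
Proof.
by apply/funext => u; apply/propext; have [uu _] := svalP u; exact: ultrafilterU.
Qed.

Lemma basicC a : basic (~` a)%O = ~` basic a.
Proof.
by apply/funext => u; apply/propext; have [uu _] := svalP u; exact: ultrafilterC.
Qed.

Lemma basicS a b : (a <= b)%O -> basic a `<=` basic b.
Proof. by move=> ab u ua; have [[_ uS _ _] _] := svalP u; exact: uS ab. Qed.

Lemma basic_open a : open (basic a).
Proof. by move=> u ua; exists a. Qed.

Lemma basic_clopen a : clopen (basic a).
Proof.
split; first exact: basic_open.
by rewrite -[basic a]setCK -basicC; apply: open_closedC; exact: basic_open.
Qed.

Lemma nbhs_basic (u : spectrum) a : sval u a -> nbhs u (basic a).
Proof. by move=> ua; apply: open_nbhs_nbhs; split=> //; exact: basic_open. Qed.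

Lemma spectrum_nbhsP (u : spectrum) U :
  nbhs u U <-> exists2 a, sval u a & basic a `<=` U.
Proof.
split=> [|[a ua aU]]; last by apply: filterS aU _; exact: nbhs_basic.
rewrite nbhsE => -[V [oV Vu] VU]; have [a ua aV] := oV u Vu.
by exists a => //; exact: subset_trans aV VU.
Qed.

Lemma spectrum_hausdorff : hausdorff_space spectrum.
Proof.
move=> u v uv; apply: spectrum_inj => a ua; apply: contrapT => nva.
have [w [wa]] : basic a `&` basic (~` a)%O !=set0.
  apply: uv; apply: nbhs_basic => //.
  by have [uv' _] := svalP v; exact/ultrafilterC.
by rewrite basicC.
Qed.

Lemma spectrum_clopen_base : has_clopen_base spectrum.
Proof.
exists (range basic); first by move=> _ [a _ <-]; exact: basic_clopen.
split=> [_ [a _ <-]|u U /spectrum_nbhsP[a ua aU]]; first exact: basic_open.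
by exists (basic a) => //; split=> //; exists a.
Qed.

(** An ultrafilter [F] of subsets containing [basic a] converges to the set of all [b] with
    [basic b] in [F]. This is a point of the spectrum because it contains [a], which lies in [I]. *)
Lemma basic_compact a : I a -> compact (basic a).
Proof.
move=> Ia; rewrite compact_ultra => F FU Fa.
have Fu : ultrafilter [set b | F (basic b)].
  split=> [/=|b c|b c|b] /=.
  - by rewrite basic0; exact: filter_not_empty.
  - by move=> Fb bc; apply: filterS Fb; exact: basicS.
  - by move=> Fb Fc; rewrite basicI; exact: filterI.
  - by rewrite basicC; exact: in_ultra_setVsetC.
exists (Spectrum Fu (ex_intro2 _ _ a Ia Fa)); split=> // U /spectrum_nbhsP[b Fb bU].
exact: filterS bU Fb.
Qed.

Lemma spectrum_locally_compact : locally_compact [set: spectrum].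
Proof.
move=> u _; have [_ [a Ia ua]] := svalP u.
exists (basic a); last by split; [exact: basic_compact|case: (basic_clopen a)].
by apply: filterS (nbhs_basic ua) => v va _.
Qed.

(** The sets [basic a] inside [K] with [a] in [I] cover [K], and joins in [I] make them directed, so
    one of them is all of [K]. *)
Lemma compact_open_basic K :
  ideal I -> compact K -> open K -> exists2 a, I a & K = basic a.
Proof.
move=> [I0 IS IU] cK oK.
have [|_ _ [a [Ia aK] <-] [b [Ib bK] <-]||u Ku|_ [a [Ia aK] <-] Ka] :=
  @compact_directed_cover _ K [set basic a | a in [set a | I a /\ basic a `<=` K]].
- exact: cK.
- exists (basic (a `|` b)%O); last by rewrite basicU.
  exists (a `|` b)%O => //; split; first exact: IU.
  by rewrite basicU subUset.
- by exists (basic \bot%O), \bot%O => //; split=> //; rewrite basic0.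
(* The element [a] need not lie in [I]; meeting it with a member [i] of both [u] and [I] repairs
   this. *)
- have [a ua aK] := oK u Ku; have [_ [i Ii ui]] := svalP u.
  have [uu _] := svalP u.
  exists (basic (a `&` i)%O); last by apply/nbhs_basic/ultrafilterI.
  exists (a `&` i)%O => //; split; first by apply: IS Ii _; exact: leIr.
  by apply: subset_trans aK; apply: basicS; exact: leIl.
- by exists a => //; exact/seteqP.
Qed.

(** If [a] were not below [b], density would give a nonzero [i] in [I] below [a] and the complement
    of [b]. An ultrafilter containing [i] meets [I], so it is a point of [basic a] outside
    [basic b]. *)
Lemma basic_subset a b : dense_ideal I -> basic a `<=` basic b -> (a <= b)%O.
Proof.
move=> dI ab; rewrite -[b]complK -disj_leC; apply/eqP; apply: contrapT.
move=> /dI[i [Ii /ultrafilter_exists[u uu ui]]].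
rewrite lexI => /andP[ia ib]; have [_ uS _ _] := uu.
have := ab (Spectrum uu (ex_intro2 _ _ i Ii ui)) (uS _ _ ui ia); rewrite /basic /= => ub.
by have /(ultrafilterC _ uu) := uS _ _ ui ib.
Qed.

Lemma basic_inj : dense_ideal I -> injective basic.
Proof.
move=> dI a b ab; apply/eqP; rewrite eq_le.
by apply/andP; split; apply: basic_subset => //; rewrite ab.
Qed.

End Spectrum.

Definition spectrum_pzlc (A : plba_obj) : pzlc_obj :=
  PzlcObj (@spectrum_locally_compact _ _ (@plba_ideal A))
    (@spectrum_clopen_base _ _ (@plba_ideal A))
    (@spectrum_hausdorff _ _ (@plba_ideal A)).

(** * Perfect maps induced by morphisms of PLBAs *)

Section SpectrumMap.
Context (A B : plba_obj) (phi : plba_hom A B).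

(** Condition (LBA) ensures that the preimage meets the ideal: a [b] in [u] and in the ideal of [B]
    lies below [phi a] for some [a] in the ideal of [A]. *)
Lemma spectrum_preimage (u : spectrum (@plba_ideal B)) :
  ultrafilter (sval phi @^-1` sval u) /\
  exists2 a, @plba_ideal A a & (sval phi @^-1` sval u) a.
Proof.
have [[p0 p1 pI pU pC] pL pP] := svalP phi; have [uu [b Jb ub]] := svalP u.
have [u0 uS uI uC] := uu; split; last first.
  by have [a Ia ba] := pL b Jb; exists a => //; exact: uS ba.
split=> [|a a' ua aa'|a a' ua ua'|a] /=; rewrite /preimage /=.
- by rewrite p0.
- by apply: uS ua _; apply/meet_idPl; rewrite -pI (meet_idPl aa').
- by rewrite pI; exact: uI.
- by rewrite pC; exact: uC.
Qed.

Definition spectrum_map (u : spectrum (@plba_ideal B)) :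
  spectrum (@plba_ideal A) := exist _ _ (spectrum_preimage u).

Lemma spectrum_map_continuous : continuous spectrum_map.
Proof.
move=> u U /spectrum_nbhsP[a ua aU]; apply/spectrum_nbhsP.
by exists (sval phi a) => // v va; exact: aU.
Qed.

(** The preimage of [basic a] is [basic (phi a)], which by condition (PLBA) is compact for [a] in
    the ideal. Closedness is checked locally: near [v] in [basic a], the image of [C] agrees with
    the image of a compact set, which is closed. *)
Lemma spectrum_map_perfect : perfect spectrum_map.
Proof.
have cphi := spectrum_map_continuous.
have [_ _ pP] := svalP phi.
have cpt a : @plba_ideal A a -> compact (spectrum_map @^-1` basic a).
  by move=> Ia; apply: basic_compact; apply: pP; exists a.
split=> // [C cC v Cv|v].
  have [_ [a Ia va]] := svalP v.
  have /(_ v)[|u [_ Cu] <-] :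
      closed (spectrum_map @` (spectrum_map @^-1` basic a `&` C)).
  - apply: compact_closed; first exact: spectrum_hausdorff.
    apply: continuous_compact; first exact: continuous_subspaceT.
    by apply: compact_closedI => //; exact: cpt.
  - move=> U vU; have [|_ [[u Cu <-] [ua Uu]]] := Cv (basic a `&` U).
      by apply: filterI => //; exact: nbhs_basic.
    by exists (spectrum_map u); split=> //; exists u.
  - by exists u.
have [_ [a Ia va]] := svalP v.
apply: (subclosed_compact _ (cpt a Ia)); last by move=> u uv; rewrite -uv in va.
apply: preimage_closed; first by move=> x _; exact: cphi.
by apply: compact_closed; [exact: spectrum_hausdorff|exact: compact_set1].
Qed.

Definition spectrum_fmap : pzlc_hom (spectrum_pzlc B) (spectrum_pzlc A) :=
  exist _ _ spectrum_map_perfect.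

End SpectrumMap.

Definition spectrum_functor : functor (opposite PLBA) PZLC.
Proof.
refine (@Functor (opposite PLBA) PZLC spectrum_pzlc
  (fun A B phi => @spectrum_fmap B A phi) _ _).
- by move=> A; apply: eq_exist; apply/funext => u; exact: spectrum_inj.
- by move=> A B C g f; apply: eq_exist; apply/funext => u; exact: spectrum_inj.
Defined.

(** * The unit and the counit *)

Section Unit.
Context (X : pzlc_obj).

Lemma evaluation_ultrafilter (x : X) :
  ultrafilter [set U : ccc X | sval U x] /\
  exists2 U : ccc X, ccc_ideal U & sval U x.
Proof.
split.
  split=> [//|U V Ux /ccc_leP|U V Ux Vx|U] /=; [exact|by []|exact: EM].
have [K [clK cK Kx _]] := compact_clopen_nbhs
  (@pzlc_locally_compact X) (@pzlc_clopen_base X) (@filterT _ (nbhs x) _).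
by exists (exist _ K (conj clK (or_introl cK))).
Qed.

Definition evaluation (x : X) : spectrum_pzlc (ccc_plba X) :=
  exist _ _ (evaluation_ultrafilter x).

Lemma evaluation_continuous : continuous evaluation.
Proof.
move=> x S /spectrum_nbhsP[U Ux US]; have [[oU _] _] := svalP U.
apply: filterS (open_nbhs_nbhs (conj oU Ux)) => y Uy; exact: US.
Qed.

Lemma evaluation_inj : injective evaluation.
Proof.
move=> x y xy; apply: (@pzlc_hausdorff X) => U V xU yV.
have [K [clK cK Kx KU]] := compact_clopen_nbhs
  (@pzlc_locally_compact X) (@pzlc_clopen_base X) xU.
exists y; split; last exact: nbhs_singleton.
apply: KU.
have := congr1 (fun u => sval u (exist _ K (conj clK (or_introl cK)))) xy.
by move=> /= <-.
Qed.

(** The point sought is one of the compact [K] common to all members of [u]. Without such a point,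
    the complements of members of [u] would form a directed cover of [K]; one of them would contain
    [K], and [u] would contain the empty set. *)
Lemma evaluation_surj (u : spectrum (@ccc_ideal X)) : exists x, evaluation x = u.
Proof.
have [[u0 uS uI uC] [K cK uK]] := svalP u.
have [[x [Kx ux]]|noK] := pselect (exists x, sval K x /\
    forall U : ccc X, sval u U -> sval U x).
  by exists x; apply/esym/spectrum_inj.
have [|_ _ [U uU <-] [V uV <-]||x Kx|_ [U uU <-] KU] :=
  @compact_directed_cover X (sval K) [set ~` sval U | U in sval u].
- exact: cK.
- exists (~` sval (U `&` V)%O); last by rewrite /= setCI.
  by exists (U `&` V)%O => //; exact: uI.
- by exists (~` sval K), K.
- have /existsNP[U /not_implyP[uU nUx]] : ~ forall U : ccc X, sval u U -> sval U x.
    by move=> ux; apply: noK; exists x.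
  exists (~` sval U); first by exists U.
  have [[_ cU] _] := svalP U.
  by apply: open_nbhs_nbhs; split=> //; exact: closed_openC.
- case: u0; rewrite (_ : \bot%O = (K `&` U)%O); first exact: uI.
  by apply: ccc_inj; apply/esym; rewrite -subset0 => x [/KU].
Qed.

Lemma evaluation_inverse_continuous (g : spectrum (@ccc_ideal X) -> X) :
  cancel g evaluation -> continuous g.
Proof.
move=> gK u U gU; apply/spectrum_nbhsP.
have [K [clK cK Kgu KU]] := compact_clopen_nbhs
  (@pzlc_locally_compact X) (@pzlc_clopen_base X) gU.
exists (exist _ K (conj clK (or_introl cK))); first by rewrite -(gK u).
by move=> v; rewrite -{1}(gK v) => /KU.
Qed.

Lemma evaluation_homeomorphism : exists g : spectrum_pzlc (ccc_plba X) -> X,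
  [/\ continuous g, cancel evaluation g & cancel g evaluation].
Proof.
have [g gK] := choice evaluation_surj; exists g; split=> // [|x].
  exact: evaluation_inverse_continuous.
by apply: evaluation_inj; exact: gK.
Qed.

Lemma evaluation_perfect : perfect evaluation.
Proof.
have [g [cg evK gK]] := evaluation_homeomorphism.
exact: perfect_homeomorphism evaluation_continuous cg evK gK.
Qed.

Definition evaluation_hom : pzlc_hom X (spectrum_pzlc (ccc_plba X)) :=
  exist _ _ evaluation_perfect.

End Unit.

Section Counit.
Context (A : plba_obj).
Let S := spectrum_pzlc A.

Let idI : ideal (@plba_ideal A).
Proof. by have [[]] := plba_is_PLBA A. Qed.

Let denseI : dense_ideal (@plba_ideal A).
Proof. by have [[]] := plba_is_PLBA A. Qed.

(** Primeness is applied to the meet of [a] and its complement, which is zero. This is what makes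
    each [basic a] compact or cocompact. *)
Lemma plba_idealVC (a : A) : plba_ideal a \/ plba_ideal (~` a)%O.
Proof.
have [_ [->|[[I0 _ _] _ pI]]] := plba_is_PLBA A; first by left.
by apply: pI; rewrite meetxC.
Qed.

Lemma basic_ccc (a : A) : compact_or_cocompact (basic a : set S).
Proof.
split; first exact: basic_clopen.
by rewrite -basicC; have [Ia|Ia] := plba_idealVC a; [left|right];
  exact: basic_compact.
Qed.

Definition stone (a : A) : ccc_plba S := exist _ _ (basic_ccc a).

(** If [basic a] is compact, it equals [basic b] for some [b] in the ideal, and density forces
    [a = b]. *)
Lemma stone_ideal (a : A) : plba_ideal (stone a) <-> plba_ideal a.
Proof.
split; last exact: basic_compact.
move=> ca; have [b Ib] := compact_open_basic idI ca (@basic_open _ _ _ a).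
by move/(basic_inj denseI) ->.
Qed.

Lemma stone_inj : injective stone.
Proof. by move=> a b /(congr1 sval)/(basic_inj denseI). Qed.

Lemma stone_surj (K : ccc_plba S) : exists a, stone a = K.
Proof.
have [[oK cK] [kK|kK]] := svalP K.
  have [a _ Ka] := compact_open_basic idI kK oK.
  by exists a; apply: ccc_inj.
have [a _ Ka] := compact_open_basic idI kK (closed_openC cK).
by exists (~` a)%O; apply: ccc_inj; rewrite /= basicC -Ka setCK.
Qed.

Lemma stone_morphism : plba_morphism (@plba_ideal A) (@ccc_ideal S) stone.
Proof.
split; first split=> [||a b|a b|a]; try apply: ccc_inj.
- exact: basic0.
- exact: basicT.
- exact: basicI.
- exact: basicU.
- exact: basicC.
- move=> K; have [a <-] := stone_surj K => /stone_ideal Ia.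
  by exists a.
- by move=> _ [a Ia <-]; exact: basic_compact.
Qed.

Definition stone_hom : plba_hom A (ccc_plba S) := exist _ _ stone_morphism.

End Counit.

Theorem theorem1p24 : dually_equivalent PZLC PLBA.
Proof.
exists ccc_functor, spectrum_functor; split.
  apply: naturally_isomorphic_sym; exists evaluation_hom; split=> [X Y f|X].
    by apply: eq_exist; apply/funext => x; exact: spectrum_inj.
  have [g [cg evK gK]] := evaluation_homeomorphism X.
  exact: (@pzlc_is_iso X _ (evaluation_hom X) g).
exists (fun A => stone_hom A); split=> [A B phi|A].
  by apply: eq_exist; apply/funext => a; exact: ccc_inj.
(* An isomorphism of [PLBA] is one of its opposite, with the two inverse laws exchanged. *)
have [g [gK Kg]] : @is_iso PLBA _ _ (stone_hom A).
  apply: plba_is_iso; first exact: stone_inj; first exact: stone_surj.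
  by move=> a /stone_ideal.
by exists g.
Qed.
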